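(* Let $K$ be a field, let $\mathbb{X}=\{p_1,\dots,p_s\}\subseteq\mathbb{P}^n_K$ be a set of $s$ distinct $K$-rational points, none on the hyperplane $X_0=0$, and for $j=1,\dots,s$ let $f_j\in R_{r_{\mathbb{X}}}$ be the separator of $\mathbb{X}\setminus\{p_j\}$ in $\mathbb{X}$ such that $f_j(p_j)=1$ and $f_j(p_k)=0$ for $k\ne j$. Then $\mathbb{X}$ is a Cayley-Bacharach scheme if and only if $x_0^{r_{\mathbb{X}}-2}f_j\notin(\delta_{\mathbb{X}})_{2r_{\mathbb{X}}-2}$ for all $j=1,\dots,s$.
   Context: $P=K[X_0,\dots,X_n]$ has the standard grading, $I_{\mathbb{X}}\subseteq P$ is the homogeneous vanishing ideal of $\mathbb{X}$ (with reduced structure), $R=P/I_{\mathbb{X}}$, and $x_0$ is the residue class of $X_0$, a non-zerodivisor of $R$. $\mathrm{HF}_{\mathbb{X}}(i)=\dim_KR_i$, and $r_{\mathbb{X}}$ is the least integer such that $\mathrm{HF}_{\mathbb{X}}(i)=s$ for all $i\ge r_{\mathbb{X}}$. Write $p_j=(1:p_{j1}:\dots:p_{jn})$; for $f\in R$ put $f(p_j)=F(1,p_{j1},\dots,p_{jn})$ for any representative $F\in P$ of $f$. The elements $f_j$ in the claim exist uniquely in $R_{r_{\mathbb{X}}}$. Cayley-Bacharach. For each $j$, $\deg_{\mathbb{X}}(p_j)$ is the least degree of a homogeneous element of $R$ vanishing at all points $p_k$, $k\neq j$, but not at $p_j$; one has $\deg_{\mathbb{X}}(p_j)\le r_{\mathbb{X}}$.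 $\mathbb{X}$ is a Cayley-Bacharach scheme if $\deg_{\mathbb{X}}(p_j)=r_{\mathbb{X}}$ for all $j$. Dedekind different. $Q^h(R)=R_{x_0}$ is the localization of $R$ at all homogeneous non-zerodivisors; $Q^h(R)\cong\prod_{j=1}^sK[T_j,T_j^{-1}]$, $\deg T_j=1$, with $f\in R_i$ mapping to $(f(p_1)T_1^i,\dots,f(p_s)T_s^i)$. $L_0=K[x_0,x_0^{-1}]$. Let $\sigma:Q^h(R)\to L_0$ be the canonical trace map of the free $L_0$-algebra $Q^h(R)$, i.e. $\sigma(h_1(T_1),\dots,h_s(T_s))=\sum_jh_j(x_0)$. Then $\underline{\mathrm{Hom}}_{L_0}(Q^h(R),L_0)=Q^h(R)\cdot\sigma$. The Dedekind complementary module $\mathfrak{C}_{\mathbb{X}}\subseteq Q^h(R)$ is the image of the injection $\underline{\mathrm{Hom}}_{K[x_0]}(R,K[x_0])\to\underline{\mathrm{Hom}}_{L_0}(Q^h(R),L_0)=Q^h(R)\sigma\cong Q^h(R)$, $\varphi\mapsto\varphi\otimes\mathrm{id}_{L_0}$ (the last isomorphism sending $g\sigma$ to $g$), and the Dedekind different is $\delta_{\mathbb{X}}=\{f\in Q^h(R)\mid f\cdot\mathfrak{C}_{\mathbb{X}}\subseteq R\}$, a homogeneous ideal of $R$. The element $x_0^{r_{\mathbb{X}}-2}f_j$ is taken in $Q^h(R)$. *)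

(* Defs.v *)
From HB Require Import structures.
From mathcomp Require Import all_boot all_order all_algebra.
From mathcomp Require Import generic_quotient ring_quotient.
From mathcomp Require Import mpoly.
From mathcomp Require Import ring.

Set Implicit Arguments.
Unset Strict Implicit.
Unset Printing Implicit Defensive.

Import GRing.Theory.
Local Open Scope ring_scope.
Local Open Scope quotient_scope.

(* The localization A_x = A[1/x] of a commutative ring at a non-zerodivisor x: *)
(* the class of (a, k) is the fraction a / x^k.                                *)
Section Localization.
Variables (A : comNzRingType) (x : A) (xreg : GRing.lreg x).

Definition loc_rel (u v : A * nat) : bool :=
  x ^+ v.2 * u.1 == x ^+ u.2 * v.1.

Lemma loc_rel_equiv : equiv_class_of loc_rel.
Proof.
split=> [u|u v|v u w]; rewrite /loc_rel ?eqxx //.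
move=> /eqP uv /eqP vw; apply/eqP; apply: (@lregX _ x v.2 xreg).
by rewrite mulrCA uv mulrCA vw mulrCA.
Qed.

Canonical loc_equiv := EquivRelPack loc_rel_equiv.
Canonical loc_encModRel := defaultEncModRel loc_rel.

Definition loc := {eq_quot loc_rel}.
Local Notation L := loc.

HB.instance Definition _ : EqQuotient _ loc_rel L := EqQuotient.on L.
HB.instance Definition _ := Choice.on L.

Definition frac (a : A) (k : nat) : L := \pi_L (a, k).
Definition numer (q : L) : A := (repr q).1.
Definition denom (q : L) : nat := (repr q).2.

Lemma fracK q : frac (numer q) (denom q) = q.
Proof. by rewrite /frac -surjective_pairing reprK. Qed.

Lemma frac_eq a k b l : (frac a k = frac b l) <-> (x ^+ l * a = x ^+ k * b).
Proof. by split=> [/eqP|e]; [|apply/eqP]; rewrite /frac piE /= /loc_rel /= ?e //; move/eqP. Qed.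

Lemma frac_repr a k :
  x ^+ k * numer (frac a k) = x ^+ denom (frac a k) * a.
Proof. by apply/frac_eq; rewrite fracK. Qed.

Definition loc_add (u v : L) : L :=
  frac (x ^+ denom v * numer u + x ^+ denom u * numer v) (denom u + denom v).
Definition loc_opp (u : L) : L := frac (- numer u) (denom u).
Definition loc_mul (u v : L) : L :=
  frac (numer u * numer v) (denom u + denom v).

Lemma frac_add a k b l :
  loc_add (frac a k) (frac b l) = frac (x ^+ l * a + x ^+ k * b) (k + l).
Proof.
apply/frac_eq; have := frac_repr a k; have := frac_repr b l.
move: (numer _) (denom _) => b' l' eb; move: (numer _) (denom _) => a' k' ea.
rewrite !mulrDr !exprD; congr (_ + _).
  transitivity (x ^+ l * x ^+ l' * (x ^+ k * a')); first by ring.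
  by rewrite ea; ring.
transitivity (x ^+ k * x ^+ k' * (x ^+ l * b')); first by ring.
by rewrite eb; ring.
Qed.

Lemma frac_opp a k : loc_opp (frac a k) = frac (- a) k.
Proof. by apply/frac_eq; rewrite !mulrN frac_repr. Qed.

Lemma frac_mul a k b l :
  loc_mul (frac a k) (frac b l) = frac (a * b) (k + l).
Proof.
apply/frac_eq; have := frac_repr a k; have := frac_repr b l.
move: (numer _) (denom _) => b' l' eb; move: (numer _) (denom _) => a' k' ea.
rewrite !exprD; transitivity ((x ^+ k * a') * (x ^+ l * b')); first by ring.
by rewrite ea eb; ring.
Qed.

Lemma loc_addA : associative loc_add.
Proof.
move=> u v w; rewrite -[u]fracK -[v]fracK -[w]fracK !frac_add.
by apply/frac_eq; rewrite !exprD; ring.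
Qed.

Lemma loc_addC : commutative loc_add.
Proof.
move=> u v; rewrite -[u]fracK -[v]fracK !frac_add.
by apply/frac_eq; rewrite !exprD; ring.
Qed.

Lemma loc_add0 : left_id (frac 0 0) loc_add.
Proof.
move=> u; rewrite -[u]fracK frac_add.
by apply/frac_eq; rewrite !exprD; ring.
Qed.

Lemma loc_addN : left_inverse (frac 0 0) loc_opp loc_add.
Proof.
move=> u; rewrite -[u]fracK frac_opp frac_add.
by apply/frac_eq; rewrite !exprD; ring.
Qed.

HB.instance Definition _ :=
  GRing.isZmodule.Build L loc_addA loc_addC loc_add0 loc_addN.

Lemma loc_mulA : associative loc_mul.
Proof.
move=> u v w; rewrite -[u]fracK -[v]fracK -[w]fracK !frac_mul.
by apply/frac_eq; rewrite !exprD; ring.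
Qed.

Lemma loc_mulC : commutative loc_mul.
Proof.
move=> u v; rewrite -[u]fracK -[v]fracK !frac_mul.
by apply/frac_eq; rewrite !exprD; ring.
Qed.

Lemma loc_mul1 : left_id (frac 1 0) loc_mul.
Proof. by move=> u; rewrite -[u]fracK frac_mul mul1r. Qed.

Lemma loc_mulD : left_distributive loc_mul loc_add.
Proof.
move=> u v w; rewrite -[u]fracK -[v]fracK -[w]fracK !(frac_mul, frac_add).
by apply/frac_eq; rewrite !exprD; ring.
Qed.

Lemma loc_1neq0 : frac 1 0 != 0.
Proof.
by apply/eqP=> /frac_eq; rewrite !expr0 !mul1r => /eqP; rewrite oner_eq0.
Qed.

HB.instance Definition _ := GRing.Zmodule_isComNzRing.Build L
  loc_mulA loc_mulC loc_mul1 loc_mulD loc_1neq0.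

(* x^m for an arbitrary integer m. *)
Definition loc_xpow (m : int) : L :=
  match m with Posz k => frac (x ^+ k) 0 | Negz k => frac 1 k.+1 end.

End Localization.

(* A nonempty set of s distinct K-rational points of P^n off the hyperplane    *)
(* X_0 = 0, given by arbitrary homogeneous coordinates.                        *)
Record pointset (K : fieldType) (n s : nat) := PointSet {
  hcoord : 'I_s -> 'rV[K]_n.+1;
  pointset_gt0 : (0 < s)%N;
  hcoord0_neq0 : forall j, hcoord j ord0 ord0 != 0;
  hcoord_distinct : forall j k (c : K), hcoord j = c *: hcoord k -> j = k
}.

(* F(v T) written as the sum of the F_d(v) T^d, F_d the homogeneous component  *)
(* of degree d of F.                                                           *)
Definition hgen (K : fieldType) (n : nat) (v : 'rV[K]_n) (F : {mpoly K[n]}) :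
    {poly K} :=
  \poly_(d < msize F) (pihomog mdeg d F).@[v ord0].

Section Hgen.
Variables (K : fieldType) (n : nat) (v : 'rV[K]_n).

Lemma hgenE F : hgen v F = mmap polyC (fun i => v ord0 i *: 'X) F.
Proof.
have hX m : mmap1 (fun i => v ord0 i *: 'X) m
    = (mmap1 (v ord0) m) *: 'X^(mdeg m).
  rewrite /mmap1 mdegE -prodrXr.
  by rewrite -scaler_prod; apply: eq_bigr => i _; rewrite exprZn.
rewrite /mmap; under eq_bigr => m _ do rewrite hX mul_polyC scalerA.
apply/polyP=> d; rewrite coef_poly coef_sum.
under eq_bigr => m _ do rewrite coefZ coefXn.
have -> : \sum_(m <- msupp F) F@_m * mmap1 (v ord0) m * (d == mdeg m)%:R
    = (pihomog mdeg d F).@[v ord0].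
  rewrite pihomogE raddf_sum /= [RHS]big_mkcond; apply: eq_bigr => m _.
  rewrite eq_sym; case: eqP => _; last by rewrite mulr0.
  by rewrite mulr1 mevalZ mevalX.
case: ltnP => // hd; rewrite pihomogE big_seq_cond big1 ?meval0 // => m /andP[mF /eqP e].
by have := msize_mdeg_lt mF; rewrite e ltnNge hd.
Qed.

Lemma coef_hgen F d : (hgen v F)`_d = (pihomog mdeg d F).@[v ord0].
Proof.
rewrite coef_poly; case: ltnP => // hd.
rewrite pihomogE big_seq_cond big1 ?meval0 // => m /andP[mF /eqP e].
by have := msize_mdeg_lt mF; rewrite e ltnNge hd.
Qed.

Lemma hgen0 : hgen v 0 = 0. Proof. by rewrite hgenE raddf0. Qed.
Lemma hgen1 : hgen v 1 = 1. Proof. by rewrite hgenE rmorph1. Qed.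
Lemma hgenD F G : hgen v (F + G) = hgen v F + hgen v G.
Proof. by rewrite !hgenE raddfD. Qed.
Lemma hgenB F G : hgen v (F - G) = hgen v F - hgen v G.
Proof. by rewrite !hgenE raddfB. Qed.
Lemma hgenM F G : hgen v (F * G) = hgen v F * hgen v G.
Proof. by rewrite !hgenE rmorphM. Qed.
Lemma hgenXi i : hgen v 'X_i = v ord0 i *: 'X.
Proof. by rewrite hgenE mmapX mmap1U. Qed.

Lemma horner_hgen F : (hgen v F).[1] = F.@[v ord0].
Proof.
rewrite hgenE mevalE /mmap horner_sum; apply: eq_bigr => m _.
rewrite hornerM hornerC /mmap1 horner_prod; congr (_ * _).
by apply: eq_bigr => i _; rewrite horner_exp hornerZ hornerX mulr1.
Qed.

End Hgen.

Lemma hgenZv (K : fieldType) n (v : 'rV[K]_n) (c : K) (F : {mpoly K[n]}) :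
  hgen (c *: v) F = hgen v F \Po (c *: 'X).
Proof.
rewrite !hgenE /mmap raddf_sum; apply: eq_bigr => m _.
rewrite /= comp_polyM comp_polyC /mmap1 rmorph_prod; congr (_ * _).
apply: eq_bigr => i _; rewrite rmorphXn /= comp_polyZ comp_polyX.
by rewrite scalerA mxE mulrC.
Qed.

Section CoordinateRing.
Variables (K : fieldType) (n s : nat) (X : pointset K n s).

(* The homogeneous vanishing ideal: all homogeneous components vanish on X. *)
Definition vanishing_ideal : pred {mpoly K[n.+1]} := fun F =>
  [forall j, all (fun d => (pihomog mdeg d F).@[hcoord X j ord0] == 0)
                 (iota 0 (msize F))].

Lemma vanishing_idealP F :
  reflect (forall j, hgen (hcoord X j) F = 0) (F \in vanishing_ideal).
Proof.
apply: (iffP forallP) => [h j|h j].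
  apply/polyP=> d; rewrite coef_poly coef0; case: ltnP => // hd.
  by have /allP/(_ d) := h j; rewrite mem_iota => /(_ hd)/eqP.
by apply/allP=> d _; rewrite -coef_hgen h coef0.
Qed.

Lemma vanishing_ideal_closed : idealr_closed vanishing_ideal.
Proof.
split.
- by apply/vanishing_idealP=> j; rewrite hgen0.
- apply/vanishing_idealP=> /(_ (Ordinal (pointset_gt0 X)))/eqP.
  by rewrite hgen1 oner_eq0.
- move=> a u v /vanishing_idealP hu /vanishing_idealP hv.
  by apply/vanishing_idealP=> j; rewrite hgenD hgenM hu hv mulr0 addr0.
Qed.

HB.instance Definition _ :=
  isIdealr.Build {mpoly K[n.+1]} vanishing_ideal vanishing_ideal_closed.

Definition vanishing_idealr : idealr {mpoly K[n.+1]} := vanishing_ideal.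

Definition coord_ring : Type := {ideal_quot vanishing_idealr}.
HB.instance Definition _ := GRing.ComNzRing.on coord_ring.
Local Notation R := coord_ring.

Definition cls (F : {mpoly K[n.+1]}) : R := \pi_({ideal_quot vanishing_idealr}) F.
Definition rep (f : R) : {mpoly K[n.+1]} := repr f.

Lemma repK f : cls (rep f) = f. Proof. exact: reprK. Qed.

Lemma cls_eq F G : cls F = cls G <-> F - G \in vanishing_ideal.
Proof.
rewrite (Quotient.idealrBE vanishing_idealr F G).
by split=> [e|/eqP//]; apply/eqP; exact: e.
Qed.

Lemma clsD F G : cls (F + G) = cls F + cls G.
Proof. exact: raddfD. Qed.
Lemma clsM F G : cls (F * G) = cls F * cls G.
Proof. exact: rmorphM. Qed.
Lemma cls1 : cls 1 = 1.
Proof. exact: rmorph1. Qed.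

Definition coord_scale (c : K) (f : R) : R := cls c%:MP * f.

Lemma coord_scaleA a b f :
  coord_scale a (coord_scale b f) = coord_scale (a * b) f.
Proof. by rewrite /coord_scale mulrA -clsM -mpolyCM. Qed.
Lemma coord_scale1 : left_id 1 coord_scale.
Proof. by move=> f; rewrite /coord_scale cls1 mul1r. Qed.
Lemma coord_scaleDr : right_distributive coord_scale +%R.
Proof. by move=> a f g; rewrite /coord_scale mulrDr. Qed.
Lemma coord_scaleDl f : {morph coord_scale^~ f : a b / a + b}.
Proof. by move=> a b; rewrite /coord_scale mpolyCD clsD mulrDl. Qed.

HB.instance Definition _ := GRing.Zmodule_isLmodule.Build K R
  coord_scaleA coord_scale1 coord_scaleDr coord_scaleDl.

Lemma coord_scaleAl (a : K) (f g : R) : a *: (f * g) = a *: f * g.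
Proof. exact: mulrA. Qed.
HB.instance Definition _ := GRing.Lmodule_isLalgebra.Build K R coord_scaleAl.

Lemma coord_scaleAr (a : K) (f g : R) : a *: (f * g) = f * (a *: g).
Proof. exact: mulrCA. Qed.
HB.instance Definition _ := GRing.Lalgebra_isAlgebra.Build K R coord_scaleAr.

Definition grade (i : nat) (f : R) : Prop :=
  exists2 F, F \is i.-homog & f = cls F.

(* dim_K R_i = d, as the size of a K-basis of R_i *)
Definition hilbert_fun (i d : nat) : Prop :=
  exists b : 'I_d -> R, (forall k, grade i (b k)) /\
    forall f, grade i f ->
      exists! c : {ffun 'I_d -> K}, f = \sum_(k < d) c k *: b k.

Definition is_least (P : nat -> Prop) (m : nat) : Prop :=
  P m /\ forall m', P m' -> (m <= m')%N.

(* r = r_X; natural numbers suffice, as R_i = 0 for i < 0 while s > 0 *)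
Definition reg_index (r : nat) : Prop :=
  is_least (fun m => forall i, (m <= i)%N -> hilbert_fun i s) r.

(* the coordinates (1 : p_j1 : ... : p_jn) of p_j *)
Definition pt (j : 'I_s) : 'rV[K]_n.+1 :=
  (hcoord X j ord0 ord0)^-1 *: hcoord X j.

(* f(p_j); independent of the chosen representative, see evpt_cls *)
Definition evpt (j : 'I_s) (f : R) : K := (rep f).@[pt j ord0].

(* f |-> \sum_i f_i(p_j) T^i, the j-th component of R -> \prod_j K[T_j];       *)
(* independent of the chosen representative, see curve_cls                     *)
Definition curve (j : 'I_s) (f : R) : {poly K} := hgen (pt j) (rep f).

Lemma curve_cls j F : curve j (cls F) = hgen (pt j) F.
Proof.
have /cls_eq/vanishing_idealP/(_ j) := repK (cls F).
rewrite /curve /pt !hgenZv hgenB => /eqP.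
by rewrite subr_eq0 => /eqP ->.
Qed.

Lemma evpt_cls j F : evpt j (cls F) = F.@[pt j ord0].
Proof. by rewrite /evpt -!horner_hgen -/(curve j _) curve_cls. Qed.

(* deg_X(p_j) = d *)
Definition point_degree (j : 'I_s) (d : nat) : Prop :=
  is_least (fun m => exists f, [/\ grade m f,
    forall k, k != j -> evpt k f = 0 & evpt j f != 0]) d.

Definition cayley_bacharach : Prop :=
  exists2 r, reg_index r & forall j, point_degree j r.

Definition x0 : R := cls 'X_ord0.

Lemma x0_lreg : GRing.lreg x0.
Proof.
apply: mulrI0_lreg => f; rewrite -[f]repK /x0 -clsM => h.
have {}h : cls ('X_ord0 * rep f) = cls 0 by rewrite h /cls raddf0.
move/cls_eq/vanishing_idealP: h; rewrite subr0 => h.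
transitivity (cls 0); last by rewrite /cls raddf0.
apply/cls_eq; rewrite subr0; apply/vanishing_idealP=> j; apply/eqP.
have /eqP := h j; rewrite hgenM hgenXi -scalerAl scaler_eq0.
by rewrite (negPf (hcoord0_neq0 X j)) /= mulf_eq0 polyX_eq0.
Qed.

End CoordinateRing.

Arguments cls {K n s X}.
Arguments grade {K n s X}.
Arguments evpt {K n s X}.
Arguments curve {K n s X}.
Arguments x0 {K n s}.
Arguments x0_lreg {K n s} X _ _ _.

Lemma polyX_lreg (K : fieldType) : GRing.lreg ('X : {poly K}).
Proof. by apply: mulfI; rewrite polyX_eq0. Qed.
Arguments polyX_lreg K _ _ _ : clear implicits.

(* K[T, T^-1]; it serves as L_0 = K[x_0, x_0^-1] and as each K[T_j, T_j^-1].   *)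
(* In the same way K[x_0] is represented by {poly K}, acting on R through      *)
(* p |-> p(x_0).                                                               *)
Notation laurent K := (loc (polyX_lreg K)).

(* Q^h(R) = R_{x_0} *)
Notation Qh X := (loc (x0_lreg X)).

Section DedekindDifferent.
Variables (K : fieldType) (n s : nat) (X : pointset K n s).
Local Notation R := (coord_ring X).

Definition toQ (f : R) : Qh X := frac (x0_lreg X) f 0.
Definition x0pow (m : int) : Qh X := loc_xpow (x0_lreg X) m.

Definition Qgrade (m : int) (q : Qh X) : Prop :=
  exists (i k : nat) (f : R),
    [/\ grade i f, q = frac (x0_lreg X) f k & m = i%:Z - k%:Z].

(* the j-th component of Q^h(R) -> \prod_j K[T_j, T_j^-1] *)
Definition Qcomp (j : 'I_s) (q : Qh X) : laurent K :=
  frac (polyX_lreg K) (curve j (numer q)) (denom q).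

Lemma Qcomp_frac j f k :
  Qcomp j (frac (x0_lreg X) f k) = frac (polyX_lreg K) (curve j f) k.
Proof.
have curveM g h : curve j (g * h : R) = curve j g * curve j h.
  by rewrite -[g]repK -[h]repK -clsM !curve_cls hgenM.
have curve_x0 m : curve j (x0 X ^+ m) = 'X^m.
  elim: m => [|m IHm]; first by rewrite expr0 -cls1 curve_cls hgen1.
  rewrite !exprS curveM IHm /x0 curve_cls hgenXi mxE mulVf ?scale1r //.
  exact: hcoord0_neq0.
by apply/frac_eq; rewrite -!curve_x0 -!curveM frac_repr.
Qed.

(* the canonical trace: (h_1(T_1), ..., h_s(T_s)) |-> \sum_j h_j(x_0) *)
Definition trace (q : Qh X) : laurent K := \sum_(j < s) Qcomp j q.

Definition Kx0_linear (phi : R -> {poly K}) : Prop :=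
  (forall f g, phi (f + g) = phi f + phi g) /\
  (forall (p : {poly K}) f, phi (horner_alg (x0 X) p * f) = p * phi f).

(* phi(R_i) is contained in K[x_0]_{i+e} for all i *)
Definition homogeneous_of_degree (e : int) (phi : R -> {poly K}) : Prop :=
  forall i f, grade i f -> forall k, (phi f)`_k != 0 -> k%:Z = i%:Z + e.

(* the graded Hom_{K[x_0]}(R, K[x_0]), the sum of its homogeneous parts *)
Definition graded_Hom (phi : R -> {poly K}) : Prop :=
  exists (m : nat) (e : 'I_m -> int) (psi : 'I_m -> R -> {poly K}),
    (forall l, Kx0_linear (psi l) /\ homogeneous_of_degree (e l) (psi l)) /\
    forall f, phi f = \sum_(l < m) psi l f.

(* phi (x) id_{L_0} : R (x) L_0 = Q^h(R) -> L_0, f/x_0^k |-> phi(f)/x_0^k *)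
Definition extend_L0 (phi : R -> {poly K}) (q : Qh X) : laurent K :=
  frac (polyX_lreg K) (phi (numer q)) (denom q).

Lemma extend_L0_frac phi f k : Kx0_linear phi ->
  extend_L0 phi (frac (x0_lreg X) f k) = frac (polyX_lreg K) (phi f) k.
Proof.
case=> _ phiM; have phiX m g : phi (x0 X ^+ m * g) = 'X^m * phi g.
  by rewrite -phiM rmorphXn /= horner_algX.
by apply/frac_eq; rewrite -!phiX frac_repr.
Qed.

(* g lies in C_X iff g sigma = phi (x) id_{L_0} for some phi *)
Definition complementary_module (g : Qh X) : Prop :=
  exists2 phi, graded_Hom phi & forall q, extend_L0 phi q = trace (g * q).

Definition dedekind_different (q : Qh X) : Prop :=
  forall g, complementary_module g -> exists f : R, q * g = toQ f.

(* (delta_X)_m *)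
Definition dedekind_different_in_degree (m : int) (q : Qh X) : Prop :=
  dedekind_different q /\ Qgrade m q.

End DedekindDifferent.

(* Main.v *)
(* Write V_i for the space of value vectors of R_i on X, with V_i = 0 for
   i < 0. The degree e part of the complementary module consists of the
   (c_j T_j^e)_j with c orthogonal to V_(-e-1), hence vanishes for e < -r.
   Under R_(x_0) = \prod_j K[T_j, T_j^-1], x_0^(r-2) f_j is T_j^(2r-2) in the
   j-th place and 0 elsewhere. If X is Cayley-Bacharach, the j-th unit vector
   is not in V_(r-1), so some c orthogonal to V_(r-1) has c_j != 0; multiplying
   by (c_k T_k^-r)_k then gives c_j T_j^(r-2) in the j-th place, which is not
   in R as it would be a separator of degree r-2. If instead f_j = x_0 h, then
   x_0^(r-2) f_j g = phi(h)(x_0) h lies in R whenever g sigma extends phi. *)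

Require Import Defs.
From HB Require Import structures.
From mathcomp Require Import all_boot all_order all_algebra.
From mathcomp Require Import mpoly ring.

Set Implicit Arguments.
Unset Strict Implicit.
Unset Printing Implicit Defensive.

Import GRing.Theory.
Local Open Scope ring_scope.

Lemma fracM (A : comNzRingType) (x : A) (xreg : GRing.lreg x) a b k l :
  Defs.frac xreg a k * Defs.frac xreg b l = Defs.frac xreg (a * b) (k + l).
Proof. exact: frac_mul. Qed.

(** * The embedding of $R$ into the product of the rings $K[T_j]$ *)

Section Curve.
Variables (K : fieldType) (n s : nat) (X : pointset K n s).
Local Notation R := (coord_ring X).
Implicit Types (f g : R) (j k : 'I_s).

Lemma pt_ord0 j : pt X j ord0 ord0 = 1.
Proof. by rewrite mxE mulVf // hcoord0_neq0. Qed.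

Fact curve_is_zmod_morphism j : zmod_morphism (curve j : R -> {poly K}).
Proof.
move=> f g; rewrite -[in LHS](repK f) -[in LHS](repK g).
have -> : cls (rep f) - cls (rep g) = cls (rep f - rep g) :> R.
  by rewrite /cls rmorphB.
by rewrite curve_cls hgenB.
Qed.

Fact curve_is_monoid_morphism j : monoid_morphism (curve j : R -> {poly K}).
Proof.
split=> [|f g]; first by rewrite -cls1 curve_cls hgen1.
by rewrite -[in LHS](repK f) -[in LHS](repK g) -clsM curve_cls hgenM.
Qed.

HB.instance Definition _ j :=
  GRing.isZmodMorphism.Build R {poly K} (curve j) (curve_is_zmod_morphism j).
HB.instance Definition _ j :=
  GRing.isMonoidMorphism.Build R {poly K} (curve j)
    (curve_is_monoid_morphism j).

Fact curve_is_scalable j : scalable (curve j : R -> {poly K}).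
Proof.
move=> c f; rewrite [c *: f]/(coord_scale c f) /coord_scale rmorphM /=.
by rewrite curve_cls hgenE mmapC mul_polyC.
Qed.

HB.instance Definition _ j :=
  GRing.isScalable.Build K R {poly K} *:%R (curve j) (curve_is_scalable j).

(** The vanishing ideal is tested at the coordinates [hcoord]; these are multiples of [pt], and
    rescaling a point only substitutes a multiple of $T$. *)
Lemma curve_inj f g : (forall j, curve j f = curve j g) -> f = g.
Proof.
move=> efg; apply/eqP; rewrite -subr_eq0; apply/eqP.
have -> : 0 = cls 0 :> R by rewrite /cls rmorph0.
rewrite -[f - g]repK; apply/cls_eq; rewrite subr0; apply/vanishing_idealP=> j.
have : curve j (f - g) = 0 by rewrite rmorphB /= efg subrr.
have -> : hcoord X j = hcoord X j ord0 ord0 *: pt X j.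
  by rewrite scalerA mulfV ?scale1r // hcoord0_neq0.
by rewrite hgenZv /curve => ->; rewrite comp_poly0.
Qed.

Lemma curve_x0 j : curve j (x0 X) = 'X.
Proof. by rewrite curve_cls hgenXi pt_ord0 scale1r. Qed.

Lemma curve_horner_alg_x0 j p : curve j (horner_alg (x0 X) p) = p.
Proof.
elim/poly_ind: p => [|p c IHp]; first by rewrite !rmorph0.
rewrite !(rmorphD, rmorphM) /= horner_algX horner_algC linearZ /= rmorph1.
by rewrite IHp curve_x0 alg_polyC.
Qed.

Lemma evpt_curve j f : evpt j f = (curve j f).[1].
Proof. by rewrite /curve horner_hgen. Qed.

Lemma curve_homog j i f : grade i f -> curve j f = evpt j f *: 'X^i.
Proof.
case=> F hF ->; rewrite curve_cls evpt_cls; apply/polyP=> d.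
rewrite coef_hgen coefZ coefXn; case: eqP => [->|/eqP di].
  by rewrite pihomog_dE // mulr1.
by rewrite (pihomog_ne0 _ hF) 1?eq_sym // meval0 mulr0.
Qed.

(** Taking the degree $d$ component extracts homogeneous separators from elements of $R$ not known
    to be homogeneous. *)
Lemma coef_curve d f : exists2 g : R, grade d g &
  forall j, evpt j g = (curve j f)`_d.
Proof.
exists (cls (pihomog mdeg d (rep f))).
  by exists (pihomog mdeg d (rep f)) => //; apply: pihomogP.
by move=> k; rewrite evpt_cls coef_hgen.
Qed.

Lemma evptM j f g : evpt j (f * g) = evpt j f * evpt j g.
Proof. by rewrite !evpt_curve rmorphM hornerM. Qed.

Lemma evptZ j c f : evpt j (c *: f) = c * evpt j f.
Proof. by rewrite !evpt_curve linearZ hornerZ. Qed.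

Lemma evpt_x0X j i : evpt j (x0 X ^+ i) = 1.
Proof. by rewrite evpt_curve rmorphXn /= curve_x0 hornerXn expr1n. Qed.

Lemma gradeZ c i f : grade i f -> grade i (c *: f).
Proof.
case=> F hF ->; exists (c *: F); first exact: rpredZ.
by rewrite -mul_mpolyC clsM.
Qed.

Lemma grade_x0XM m i f : grade i f -> grade (m + i) (x0 X ^+ m * f).
Proof.
case=> F hF ->; exists ('X_ord0 ^+ m * F); last by rewrite clsM /cls rmorphXn.
apply: dhomogM => //; rewrite mpolyXn dhomogX /=.
by rewrite mdegMn mdeg1 mul1n.
Qed.

Lemma x0pow_mul_x0 m : x0pow X m * toQ (x0 X) = x0pow X (m + 1).
Proof.
case: m => [k|[|k]]; rewrite /x0pow /toQ.
- by rewrite -PoszD addn1 /= fracM exprSr.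
- by rewrite /= fracM; apply/frac_eq; ring.
- have -> : Negz k.+1 + 1 = Negz k by rewrite !NegzE; ring.
  by rewrite /= fracM; apply/frac_eq; rewrite !addn0 !exprS; ring.
Qed.

Lemma Qgrade_x0pow_mul m i f :
  grade i f -> Qgrade (m + i%:Z) (x0pow X m * toQ f).
Proof.
move=> fi; case: m => l.
  exists (l + i)%N, 0%N, (x0 X ^+ l * f); split.
  - exact: grade_x0XM.
  - by rewrite fracM.
  - by rewrite PoszD subr0.
exists i, l.+1, f; split; [by []| |by rewrite NegzE addrC].
by rewrite -[f in RHS]mul1r -[l.+1 in RHS]addn0 -fracM.
Qed.

End Curve.

(** * Linear algebra on value vectors, and the trace *)

Section DedekindDifferent.
Variables (K : fieldType) (n s : nat) (X : pointset K n s).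
Local Notation R := (coord_ring X).
Implicit Types (f g h : R) (j k : 'I_s).

(** The hypothesis keeps the $j$-th unit vector out of $V_{r-1}$, so some column of a cokernel
    matrix kills $V_{r-1}$ but not that vector. *)
Lemma exists_annihilator r j :
  (forall m f, grade m f -> (forall k, k != j -> evpt k f = 0) ->
    evpt j f != 0 -> (r <= m)%N) ->
  exists2 c : 'I_s -> K, c j != 0 &
    forall i f, (i < r)%N -> grade i f -> \sum_k c k * evpt k f = 0.
Proof.
move=> minr.
(* Monomials of all degrees below $r$ occur: at points with $X_0 = 1$, padding with powers of $X_0$
   keeps the values, so the rows span $V_{r-1}$. *)
pose A : 'M[K]_(#|{: 'X_{1..n.+1 < r}}|, s) :=
  \matrix_(a, k) ('X_[bmnm (enum_val a)] : {mpoly K[n.+1]}).@[pt X k ord0].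
pose e : 'rV[K]_s := delta_mx 0 j.
have : ~~ (e <= A)%MS.
  apply/negP=> /submxP[u eu].
  pose F : {mpoly K[n.+1]} := \sum_a u 0 a *:
    ('X_ord0 ^+ (r.-1 - mdeg (enum_val a)) * 'X_[bmnm (enum_val a)]).
  have evF k : evpt k (cls F : R) = (k == j)%:R.
    have := congr1 (fun M : 'rV_s => M 0 k) eu.
    rewrite !mxE eqxx /= => ->; rewrite evpt_cls raddf_sum /=.
    apply: eq_bigr => a _; rewrite mevalZ mevalM rmorphXn /= mevalXU pt_ord0.
    by rewrite expr1n mul1r mxE.
  have r_le : (r <= r.-1)%N.
    apply: (minr _ (cls F)).
    - exists F => //; apply: rpred_sum => a _; apply: rpredZ.
      have ltr : (mdeg (enum_val a) < r)%N by exact: bmdeg.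
      rewrite mpolyXn -mpolyXD dhomogX /= mdegD mdegMn mdeg1 mul1n.
      by rewrite subnK // -ltnS prednK // (leq_ltn_trans _ ltr).
    - by move=> k /negPf kj; rewrite evF kj.
    - by rewrite evF eqxx oner_eq0.
  (* The truncated predecessor leaves only $r = 0$; then [F] is an empty sum, contradicting its
     value 1 at $p_j$. *)
  have r0 : r = 0%N by case: r r_le {minr A eu F evF u} => // m; rewrite ltnn.
  have := evF j; rewrite /F big1 => [|a _].
    by rewrite evpt_cls meval0 eqxx => /esym/eqP; rewrite oner_eq0.
  by have := bmdeg (enum_val a); rewrite [X in (_ < X)%N]r0.
rewrite submxE => /eqP/matrixP eA.
have [l cl] : exists l, cokermx A j l != 0.
  apply/existsP; apply: contra_notT eA => /existsPn c0 i l.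
  rewrite mxE big1 ?mxE // => k _; rewrite mxE ord1 eqxx /=.
  case: eqP => [->|_]; last by rewrite mul0r.
  by rewrite (eqP (negPn (c0 l))) mulr0.
exists (cokermx A ^~ l) => // i _ ir [F hF ->].
under eq_bigr => k _ do
  rewrite evpt_cls {1}(mpolyE F) raddf_sum /= mulr_sumr.
rewrite exchange_big big_seq big1 //= => m mF.
have mdm : (mdeg m < r)%N by rewrite (dhomog_mf hF mF).
have /matrixP/(_ (enum_rank (BMultinom mdm)) l) := mulmx_coker A.
rewrite !mxE => e0; apply: etrans (mulr0 F@_m).
rewrite -[in RHS]e0 mulr_sumr.
by apply: eq_bigr => k _; rewrite mevalZ [A _ _]mxE enum_rankK mulrC mulrA.
Qed.

(* Multiplying by x_0^2 avoids the negative exponents of x_0 when r < 2. *)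
Lemma x0pow_sub2_mul r f :
  x0pow X (r%:Z - 2) * toQ f * toQ (x0 X ^+ 2) = toQ (x0 X ^+ r * f).
Proof.
have toQM (a b : R) : toQ (a * b) = toQ a * toQ b by exact/esym/frac_mul.
rewrite expr2 toQM mulrAC [x0pow _ _ * _]mulrA !x0pow_mul_x0.
by rewrite toQM; congr (_ * _); rewrite -addrA subrK.
Qed.

Lemma trace_frac f l :
  trace (Defs.frac (x0_lreg X) f l) =
  Defs.frac (polyX_lreg K) (\sum_j curve j f) l.
Proof.
rewrite /trace; under eq_bigr => j _ do rewrite Qcomp_frac.
elim/big_rec2: _ => [|j p q _ ->]; first by apply/frac_eq; rewrite !mulr0.
apply: (etrans (frac_add _ _ _ _ _)).
by apply/frac_eq; rewrite -mulrDr exprD mulrA.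
Qed.

(** * From an annihilator to an element of the complementary module *)

Section Functional.
Variables (r : nat) (c : 'I_s -> K).
Hypothesis c_annihilates : forall i f, (i < r)%N -> grade i f ->
  \sum_k c k * evpt k f = 0.

(* The form on R defining the element (c_k T_k^-r)_k of C_X. *)
Definition functional f : {poly K} := drop_poly r (\sum_k c k *: curve k f).

(** By [c_annihilates] the sum has no coefficient below degree $r$, so [drop_poly] is an exact
    division by $T^r$. *)
Lemma functionalE f : 'X^r * functional f = \sum_k c k *: curve k f.
Proof.
rewrite -[RHS](poly_take_drop r) mulrC -[LHS]add0r; congr (_ + _).
apply/esym/polyP=> d; rewrite coef_take_poly coef0; case: ifP => // dr.
have [g gd ev] := coef_curve d f.
rewrite -[RHS](c_annihilates dr gd) coef_sum.
by apply: eq_bigr => k _; rewrite coefZ ev.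
Qed.

Lemma functional_linear : Kx0_linear functional.
Proof.
have Xr_inj : injective (fun p : {poly K} => 'X^r * p).
  by apply: mulfI; rewrite monic_neq0 ?monicXn.
split=> [f g|p f]; apply: Xr_inj => /=.
  rewrite mulrDr !functionalE -big_split; apply: eq_bigr => k _ /=.
  by rewrite rmorphD scalerDr.
rewrite mulrCA !functionalE mulr_sumr; apply: eq_bigr => k _.
by rewrite rmorphM /= curve_horner_alg_x0 scalerAr.
Qed.

Lemma functional_homog : homogeneous_of_degree (- r%:Z) functional.
Proof.
move=> i f fi m; rewrite coef_drop_poly coef_sum.
under eq_bigr => k _ do
  rewrite (curve_homog _ fi) scalerA coefZ coefXn.
case: ((m + r)%N =P i) => [<- _|_]; first by rewrite PoszD addrK.
by rewrite big1 ?eqxx //= => k _; rewrite mulr0.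
Qed.

(** As [h k] is $T_k^r$ in place $k$ and 0 elsewhere, the fraction is $(c_k T_k^{-r})_k$;
    multiplying by it and taking the trace extends [functional]. *)
Lemma functional_complementary (h : 'I_s -> R) :
  (forall k l, curve l (h k) = (l == k)%:R *: 'X^r) ->
  complementary_module
    (Defs.frac (x0_lreg X) (\sum_k c k *: h k) (r + r)).
Proof.
move=> hE; exists functional.
  exists 1%N, (fun=> - r%:Z), (fun=> functional); split=> [_|f].
    by split; [exact: functional_linear | exact: functional_homog].
  by rewrite big_ord1.
move=> q; rewrite -[q]fracK fracM trace_frac.
rewrite (extend_L0_frac _ _ functional_linear); apply/frac_eq.
rewrite addnC !exprD -!mulrA functionalE; congr (_ * _).
rewrite mulr_sumr; apply: eq_bigr => k _.
rewrite rmorphM /= raddf_sum /= (bigD1 k) //= big1 => [|l lk].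
  by rewrite addr0 linearZ /= hE eqxx scale1r -!scalerAl scalerAr.
by rewrite linearZ /= hE eq_sym (negPf lk) scale0r scaler0.
Qed.

End Functional.

(** * Separators divisible by $x_0$ *)

Lemma graded_Hom_linear (phi : R -> {poly K}) :
  graded_Hom phi -> Kx0_linear phi.
Proof.
move=> [m [e [psi [psiP phiE]]]]; split=> [f g|p f]; rewrite !phiE.
  by rewrite -big_split; apply: eq_bigr => l _; exact: (psiP l).1.1.
by rewrite mulr_sumr; apply: eq_bigr => l _; exact: (psiP l).1.2.
Qed.

(** Here [f] has degree $r+1$, whence the shifted exponent; the element equals $x_0^r h$. *)
Lemma separator_in_different r j f h :
  grade r h -> (forall k, evpt k h = (k == j)%:R) ->
  f = x0 X * h ->
  dedekind_different (x0pow X (r.+1%:Z - 2) * toQ f).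
Proof.
move=> hr hE -> g [phi phi_hom gE].
have x0E : x0pow X (r.+1%:Z - 2) * toQ (x0 X * h) = toQ (x0 X ^+ r * h).
  have -> : toQ (x0 X * h) = toQ (x0 X) * toQ h by rewrite /toQ fracM.
  rewrite mulrA x0pow_mul_x0 -addn1 PoszD -!addrA addr0.
  by rewrite /x0pow /toQ /= fracM.
have cE k : curve k h = (k == j)%:R *: 'X^r.
  by rewrite (curve_homog _ hr) hE.
exists (horner_alg (x0 X) (phi h) * h); rewrite x0E.
(* Evaluating at [h] isolates the $j$-th place: $g_j T^r = \varphi(h)$. Hence $x_0^r h g$ is $T^r
   \varphi(h)$ there, as is $\varphi(h)(x_0) h$. *)
have := gE (toQ h); rewrite -[g]fracK /toQ !fracM trace_frac.
rewrite (extend_L0_frac _ _ (graded_Hom_linear phi_hom)).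
move: (numer g) (denom g) => a l /frac_eq.
rewrite addn0 add0n expr0 mul1r => phiE.
apply/frac_eq; rewrite expr0 mul1r; apply: curve_inj => k.
rewrite !rmorphM !rmorphXn /= curve_x0 curve_horner_alg_x0 cE.
case: eqP => [->|_]; last by rewrite scale0r !(mulr0, mul0r).
rewrite scale1r [RHS]mulrA phiE (bigD1 j) //= big1 => [|i /negPf ij].
  by rewrite addr0 rmorphM /= cE eqxx scale1r; ring.
by rewrite rmorphM /= cE ij scale0r mulr0.
Qed.

End DedekindDifferent.

(** * The Cayley-Bacharach property in terms of the different *)

Theorem corollary5p10 (K : fieldType) (n s : nat) (X : pointset K n s)
    (r : nat) (hr : reg_index X r)
    (f : 'I_s -> coord_ring X)
    (f_deg : forall j, grade r (f j))
    (f_self : forall j, evpt j (f j) = 1)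
    (f_other : forall j k, k != j -> evpt k (f j) = 0) :
  cayley_bacharach X <->
  forall j, ~ dedekind_different_in_degree (2 * r%:Z - 2)
                (x0pow X (r%:Z - 2) * toQ (f j)).
Proof.
have fE j k : curve k (f j) = (k == j)%:R *: 'X^r.
  rewrite (curve_homog _ (f_deg j)).
  by case: eqP => [->|/eqP/f_other->]; rewrite ?f_self.
split=> [[r' [hr' _] CB] j [dj _]|nd].
  have minr m (g : coord_ring X) : grade m g ->
      (forall k, k != j -> evpt k g = 0) -> evpt j g != 0 -> (r <= m)%N.
    move=> gm g0 gj; apply: leq_trans (hr.2 _ hr') _.
    by apply: (CB j).2; exists g.
  have [c cj c_ann] := exists_annihilator minr.
  have [F eF] := dj _ (functional_complementary c_ann fE).
  (* The factor $x_0^2$ turns $x_0^{r-2}$ into $x_0^r$; the factor $x_0^{2r}$ clears the denominator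
     of the element of $\mathfrak{C}_{\mathbb{X}}$. *)
  have {eF} : toQ (x0 X ^+ r * f j * \sum_k c k *: f k) =
      Defs.frac (x0_lreg X) (x0 X ^+ 2 * F) 0 *
        Defs.frac (x0_lreg X) (x0 X ^+ (r + r)) 0.
    have -> : Defs.frac (x0_lreg X) (x0 X ^+ 2 * F) 0 =
        toQ (x0 X ^+ 2) * toQ F by rewrite fracM.
    rewrite -eF mulrA [toQ _ * _]mulrC x0pow_sub2_mul -[RHS]mulrA /toQ !fracM.
    by apply/frac_eq; rewrite addn0 expr0 mul1r mulrC -!mulrA.
  rewrite fracM => /frac_eq; rewrite !expr0 !mul1r => eF.
  (* In place $k$, cancelling $T^{2r}$ leaves a multiple of $T^r$ equal to $T^2$ times the curve of
     [F]. *)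
  have coef_F k : (k == j)%:R * c j = ('X^2 * curve k F)`_r.
    have := congr1 (curve k) eF; rewrite !rmorphM !rmorphXn /= curve_x0 fE.
    rewrite raddf_sum (bigD1 k) //= big1 ?addr0 => [|l lk]; last first.
      by rewrite linearZ /= fE eq_sym (negPf lk) scale0r scaler0.
    rewrite linearZ /= fE eqxx scale1r => eFk.
    have /(congr1 (fun p : {poly K} => p`_r)) :
        ((k == j)%:R * c k) *: 'X^r = 'X^2 * curve k F.
      apply: (@mulfI _ ('X^r * 'X^r)).
        by rewrite -exprD monic_neq0 ?monicXn.
      by rewrite -[RHS]mulrC -exprD -eFk -!mul_polyC polyCM exprD; ring.
    rewrite coefZ coefXn eqxx mulr1 => <-.
    by case: eqP => [->//|_]; rewrite !mul0r.
  (* A multiple of $T^2$ has no coefficient below degree 2, so $r < 2$ would give $c_j = 0$. Hence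
     [r - 2] is not truncated. *)
  have r_ge2 : (2 <= r)%N.
    rewrite leqNgt; apply: contra cj => r2.
    by have := coef_F j; rewrite eqxx mul1r coefXnM r2 => ->.
  (* This component of [F] separates $p_j$ in degree $r-2$, against [minr]. *)
  have [g gd gE] := coef_curve (r - 2) F.
  have {coef_F}gE k : evpt k g = (k == j)%:R * c j.
    by rewrite gE coef_F coefXnM ltnNge r_ge2.
  have : (r <= r - 2)%N.
    apply: (minr _ _ gd) => [k /negPf kj|]; rewrite gE ?kj ?mul0r //.
    by rewrite eqxx mul1r.
  by rewrite leqNgt ltn_subrL (leq_trans _ r_ge2).
exists r => // j; split=> [|m [g [gm g_other g_self]]].
  by exists (f j); split; rewrite ?f_self ?oner_eq0 // => k; exact: f_other.
rewrite leqNgt; apply/negP=> mr; apply: (nd j); split; last first.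
  have -> : 2 * r%:Z - 2 = (r%:Z - 2) + r%:Z by ring.
  exact: Qgrade_x0pow_mul.
(* The index is positive since $m < r$; from here on [r] denotes its predecessor. *)
case: r mr {hr nd} f_deg fE => // r mr f_deg fE.
(* The separator of degree $m$ is lifted by powers of $x_0$ and normalised at $p_j$, so that $f_j =
   x_0 h$. *)
pose h := (evpt j g)^-1 *: (x0 X ^+ (r - m) * g).
have hr : grade r h by rewrite -[r](@subnK m r mr); apply/gradeZ/grade_x0XM.
have hE k : evpt k h = (k == j)%:R.
  rewrite evptZ evptM evpt_x0X mul1r.
  by case: eqP => [->|/eqP/g_other->]; rewrite ?mulVf ?mulr0.
apply: (separator_in_different hr hE).
apply: curve_inj => k; rewrite fE rmorphM /= curve_x0.
by rewrite (curve_homog _ hr) hE -scalerAr exprS.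
Qed.
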